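(* Let $\mathcal{C}$ be a $d$-uniform clutter with $n$ vertices. If $\mathcal{C}$ has the max-flow min-cut property, then $\mathcal{C}$ has a perfect matching if and only if $n=d\,\alpha_0(\mathcal{C})$.
   Context: A clutter $\mathcal{C}$ with finite vertex set $X=\{x_1,\ldots,x_n\}$ is a family of subsets of $X$ (called edges), none of which is included in another. Standing assumption: $\mathcal{C}$ has no isolated vertices, i.e., each vertex lies in at least one edge. $\mathcal{C}$ is $d$-uniform if every edge has exactly $d$ vertices. If $f_1,\ldots,f_q$ are the edges, the incidence matrix $A$ is the $n\times q$ matrix whose columns are $v_k=\sum_{x_i\in f_k}e_i\in\{0,1\}^n$. A minimal vertex cover is a subset of $X$ meeting every edge and minimal under inclusion with this property; $\alpha_0(\mathcal{C})$ is the smallest cardinality of a minimal vertex cover. A perfect matching is a set of pairwise disjoint edges whose union is $X$. $\mathcal{C}$ has the max-flow min-cut property if for every non-negative integral vector $\alpha\in\mathbb{N}^n$ both sides of the LP-duality equation $\min\{\langle\alpha,x\rangle \mid x\geq 0,\ xA\geq\mathbf{1}\}=\max\{\langle y,\mathbf{1}\rangle \mid y\geq 0,\ Ay\leq\alpha\}$ have integral optimum solutions $x$ and $y$, where $\mathbf{1}=(1,\ldots,1)$. *)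

(* Defs.v *)
From HB Require Import structures.
From mathcomp Require Import all_boot all_order all_algebra.

Set Implicit Arguments.
Unset Strict Implicit.
Unset Printing Implicit Defensive.

Import Order.TTheory GRing.Theory Num.Theory.
Local Open Scope ring_scope.

Section Clutter.
Variable n : nat.
Implicit Types (C M : {set {set 'I_n}}) (X e f : {set 'I_n}).

Definition clutter C : Prop :=
  forall e f, e \in C -> f \in C -> e \subset f -> e = f.

Definition no_isolated_vertices C : Prop :=
  forall i : 'I_n, exists2 e, e \in C & i \in e.

Definition uniform (d : nat) C : Prop := forall e, e \in C -> #|e| = d.

Definition vertex_cover C X : bool := [forall e in C, X :&: e != set0].

Definition min_vertex_cover C X : bool := minset (vertex_cover C) X.

(* The default n is never below the cardinality of a subset of 'I_n, so this
   is the minimum as soon as C has a vertex cover, i.e. set0 \notin C. *)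
Definition alpha0 C : nat :=
  \big[minn/n]_(X : {set 'I_n} | min_vertex_cover C X) #|X|.

Definition perfect_matching C M : bool :=
  [&& M \subset C, trivIset M & cover M == [set: 'I_n]].

Definition incidence_mx (R : pzSemiRingType) C : 'M[R]_(n, #|C|) :=
  \matrix_(i < n, k < #|C|) (i \in (enum_val k : {set 'I_n}))%:R.

End Clutter.

Definition lemx (R : numDomainType) (m p : nat) (A B : 'M[R]_(m, p)) : Prop :=
  forall i j, A i j <= B i j.

Definition integral_mx (R : pzRingType) (m p : nat) (A : 'M[R]_(m, p)) : Prop :=
  exists Z : 'M[int]_(m, p), A = map_mx intr Z.

Section MaxFlowMinCut.
Variables (R : realFieldType) (n : nat) (C : {set {set 'I_n}}).
Implicit Types (alpha : 'cV[nat]_n) (x : 'rV[R]_n) (y : 'cV[R]_#|C|).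

Let A : 'M[R]_(n, #|C|) := incidence_mx R C.

Definition natcol alpha : 'cV[R]_n := map_mx (fun k : nat => k%:R) alpha.

Definition primal_feasible x : Prop :=
  lemx 0 x /\ lemx (const_mx 1) (x *m A).

Definition primal_value alpha x : R := \sum_i natcol alpha i 0 * x 0 i.

Definition primal_optimal alpha x : Prop :=
  primal_feasible x /\
  forall x', primal_feasible x' -> primal_value alpha x <= primal_value alpha x'.

Definition dual_feasible alpha y : Prop :=
  lemx 0 y /\ lemx (A *m y) (natcol alpha).

Definition dual_value y : R := \sum_k y k 0.

Definition dual_optimal alpha y : Prop :=
  dual_feasible alpha y /\
  forall y', dual_feasible alpha y' -> dual_value y' <= dual_value y.

(* Optimality is over all feasible vectors with coefficients in R. The equality
   of the two optimum values is LP duality, and is not part of the property. *)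
Definition max_flow_min_cut : Prop :=
  forall alpha,
    (exists2 x, integral_mx x & primal_optimal alpha x) /\
    (exists2 y, integral_mx y & dual_optimal alpha y).

End MaxFlowMinCut.

(* Main.v *)
(** Since the clutter is d-uniform, the constant vector 1/d is a fractional
    vertex cover of weight n/d, and integrality of the covering problem makes
    alpha0 a lower bound for the weight of every fractional cover; hence
    d * alpha0 <= n, while a perfect matching (n/d disjoint edges) forces the
    reverse inequality.  Conversely, if n = d * alpha0 then 1/d is an optimal
    fractional cover.  Were the all-ones vector outside the cone spanned by the
    edges, moving 1/d slightly along a separating vector (Farkas) would give a
    strictly lighter fractional cover.  So there is a fractional perfect
    matching, of weight n/d; an integral optimal packing has at least this
    weight, hence is a perfect matching. *)

Require Import Defs.
From mathcomp Require Import all_boot all_order all_algebra.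

Set Implicit Arguments.
Unset Strict Implicit.
Unset Printing Implicit Defensive.

Import Order.TTheory GRing.Theory Num.Theory.
Local Open Scope ring_scope.

(** * Farkas' lemma over an ordered field *)

(** Induction on the number of generators. If [z] separates [b] from the cone of the last generators
    but is negative on the first one, [a], the induction hypothesis is applied again after
    projecting along [a]. *)
Lemma farkas (R : realFieldType) (n m : nat) (A : 'M[R]_(n, m)) (b : 'cV[R]_n) :
  (exists2 y : 'cV[R]_m, lemx 0 y & A *m y = b) \/
  (exists2 z : 'rV[R]_n, lemx 0 (z *m A) & (z *m b) 0 0 < 0).
Proof.
elim: m => [|m IHm] in A b *.
  have [-> | b_neq0] := eqVneq b 0.
    by left; exists 0; [move=> i j; rewrite lexx | rewrite mulmx0].
  right; exists (- b^T); first by move=> i [].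
  have sumE : (b^T *m b) 0 0 = \sum_i b i 0 ^+ 2.
    by rewrite mxE; apply: eq_bigr => i _; rewrite mxE.
  rewrite mulNmx mxE oppr_lt0 sumE lt_neqAle sumr_ge0 ?andbT; last first.
    by move=> i _; apply: sqr_ge0.
  apply: contra b_neq0; rewrite eq_sym psumr_eq0 => [/allP b0|i _].
    apply/eqP/colP => i; rewrite mxE; apply/eqP.
    by rewrite -sqrf_eq0 (implyP (b0 i _)) ?mem_index_enum.
  exact: sqr_ge0.
rewrite -[m.+1]/(1 + m)%N in A *.
rewrite -[A]hsubmxK; move: (lsubmx A) (rsubmx A) => a B {A}.
have [[y y_ge0 <-] | [z zB_ge0 zb_lt0]] := IHm B b.
  left; exists (col_mx 0 y); last by rewrite mul_row_col mulmx0 add0r.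
  move=> i j; rewrite !mxE; case: split => k; first by rewrite mxE.
  by have := y_ge0 k j; rewrite mxE.
pose za := (z *m a) 0 0.
have zaE : z *m a = za%:M by exact: mx11_scalar.
have [za_ge0 | za_lt0] := lerP 0 za.
  right; exists z => // i j; rewrite mul_mx_row !mxE.
  case: split => k; last by have := zB_ge0 i k; rewrite !mxE.
  by rewrite !ord1; move: za_ge0; rewrite /za mxE.
have za_neq0 : za != 0 by rewrite lt_eqF.
(* The projection onto the hyperplane z = 0 along the new generator a. *)
pose P : 'M[R]_n := 1%:M - za^-1 *: (a *m z).
have Pa : P *m a = 0.
  rewrite mulmxBl mul1mx -scalemxAl -mulmxA zaE mul_mx_scalar scalerA.
  by rewrite mulVf // scale1r subrr.
have [[y y_ge0 PBy] | [w wPB_ge0 wPb_lt0]] := IHm (P *m B) (P *m b).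
  (* Since [P] kills [b - B *m y], this vector is [za^-1 * t] times [a]; the coefficient is
     nonnegative because [t <= 0] and [za < 0]. *)
  pose t := (z *m (b - B *m y)) 0 0.
  have t_le0 : t <= 0.
    rewrite /t mulmxBr mulmxA mxE [X in _ + X]mxE subr_le0.
    apply: (le_trans (ltW zb_lt0)); rewrite mxE; apply: sumr_ge0 => k _.
    apply: mulr_ge0; first by have := zB_ge0 0 k; rewrite mxE.
    by have := y_ge0 k 0; rewrite mxE.
  left; exists (col_mx (za^-1 * t)%:M y).
    move=> i j; rewrite !mxE; case: split => k; last by have := y_ge0 k j; rewrite mxE.
    by rewrite mxE !ord1 mulr1n mulr_le0 ?invr_le0 // ltW.
  rewrite mul_row_col mul_mx_scalar; apply/eqP; rewrite -subr_eq0 -addrA addrC.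
  move/eqP: PBy; rewrite -mulmxA eq_sym -subr_eq0 -mulmxBr mulmxBl mul1mx.
  rewrite -scalemxAl -mulmxA [z *m _]mx11_scalar mul_mx_scalar scalerA -/t.
  move/eqP => bE; rewrite -oppr_eq0 opprD opprB bE.
  by [].
(* [w *m P] vanishes on [a], and takes on [B] and [b] the values of [w] on their projections. *)
right; exists (w *m P); last by rewrite -mulmxA.
move=> i j; rewrite mul_mx_row -mulmxA Pa mulmx0 !mxE.
case: split => k; first by rewrite mxE.
by have := wPB_ge0 i k; rewrite mulmxA mxE.
Qed.

(** * Vertex covers and perfect matchings *)

Section Clutter.
Variable n : nat.
Implicit Types (C M : {set {set 'I_n}}) (X : {set 'I_n}).

Lemma alpha0_le C X : vertex_cover C X -> (alpha0 C <= #|X|)%N.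
Proof.
move=> coverX; have [Y minY subYX] := minset_exists coverX.
apply: leq_trans (subset_leq_card subYX).
rewrite /alpha0; elim: index_enum (mem_index_enum Y) => // Z r IHr.
rewrite inE big_cons => /predU1P[<-|/IHr le_r]; first by rewrite ifT ?geq_minl.
by case: ifP => // _; apply: leq_trans (geq_minr _ _) le_r.
Qed.

Lemma alpha0_le_card C : (alpha0 C <= n)%N.
Proof.
by rewrite /alpha0; elim/big_rec: _ => // X m _ le_mn; rewrite geq_min le_mn orbT.
Qed.

(** The bound [m <= n] takes care of the default value of the minimum. *)
Lemma alpha0_ge C m : (m <= n)%N ->
  (forall X, vertex_cover C X -> (m <= #|X|)%N) -> (m <= alpha0 C)%N.
Proof.
move=> le_mn le_mX; rewrite /alpha0; elim/big_rec: _ => // X k minX le_mk.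
by rewrite leq_min le_mk le_mX // (minsetp minX).
Qed.

Lemma perfect_matching_le_cover C M X :
  perfect_matching C M -> vertex_cover C X -> (#|M| <= #|X|)%N.
Proof.
case/and3P=> /subsetP subMC trivM /eqP coverM /forall_inP coverX.
(* As [M] partitions the vertices, [X] is counted edge by edge; each edge contributes at least
   one. *)
have -> : #|X| = (\sum_(e in M) \sum_(i in e) (i \in X))%N.
  rewrite -big_trivIset //= coverM -sum1_card big_mkcond /=.
  by apply: eq_big => i; rewrite ?inE //; case: (i \in X).
rewrite -sum1_card; apply: leq_sum => e /subMC/coverX/set0Pn[i].
by rewrite inE => /andP[iX ie]; rewrite (bigD1 i) //= iX.
Qed.

Lemma card_perfect_matching C M d :
  uniform d C -> perfect_matching C M -> (#|M| * d)%N = n.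
Proof.
move=> unifC /and3P[/subsetP subMC trivM /eqP coverM].
rewrite -[RHS]card_ord -cardsT -coverM -(eqP trivM) -sum_nat_const.
by apply: eq_bigr => e /subMC/unifC.
Qed.

Lemma uniform_gt0 C d :
  no_isolated_vertices C -> uniform d C -> (0 < n)%N -> (0 < d)%N.
Proof.
move=> noisoC unifC n_gt0; have [e eC ie] := noisoC (Ordinal n_gt0).
by rewrite -(unifC e eC) card_gt0; apply/set0Pn; exists (Ordinal n_gt0).
Qed.

End Clutter.

(** * Fractional covers and packings *)

Section LinearPrograms.
Variables (R : realFieldType) (n d : nat) (C : {set {set 'I_n}}).

Lemma row_mul_incidenceE (x : 'rV[R]_n) i k :
  (x *m incidence_mx R C) i k = \sum_(j in (enum_val k : {set 'I_n})) x 0 j.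
Proof.
rewrite ord1 mxE [RHS]big_mkcond /=; apply: eq_bigr => j _.
by rewrite mxE mulr_natr mulrb.
Qed.

Lemma row_const_mul_incidenceE (t : R) i k : uniform d C ->
  ((const_mx t : 'rV[R]_n) *m incidence_mx R C) i k = t * d%:R.
Proof.
move=> unifC; rewrite row_mul_incidenceE (eq_bigr (fun=> t)) => [|j _].
  by rewrite sumr_const (unifC _ (enum_valP k)) mulr_natr.
by rewrite mxE.
Qed.

(** Double counting: the weight of each edge is collected once at each of its [d] vertices. *)
Lemma sum_incidence_mul (y : 'cV[R]_#|C|) : uniform d C ->
  \sum_i (incidence_mx R C *m y) i 0 = d%:R * dual_value y.
Proof.
move=> unifC.
have -> : \sum_i (incidence_mx R C *m y) i 0 =
    ((const_mx 1 : 'rV[R]_n) *m (incidence_mx R C *m y)) 0 0.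
  by rewrite [RHS]mxE; apply: eq_bigr => i _; rewrite [in RHS]mxE mul1r.
rewrite mulmxA mxE mulr_sumr; apply: eq_bigr => k _.
by rewrite row_const_mul_incidenceE // mul1r.
Qed.

Lemma alpha0_le_fractional_cover (x : 'rV[R]_n) :
  max_flow_min_cut R C -> primal_feasible C x -> (alpha0 C)%:R <= \sum_i x 0 i.
Proof.
move=> mfmcC feasx.
have valueE x' : primal_value (const_mx 1%N) x' = \sum_i x' 0 i :> R.
  by apply: eq_bigr => i _; rewrite !mxE mul1r.
have [[_ [z ->] [[z_ge0 z_cov] z_opt]] _] := mfmcC (const_mx 1%N).
have := z_opt x feasx; rewrite !valueE; apply: le_trans.
(* The support of an integral optimal cover for unit costs meets every edge, and has at most as many
   vertices as the weight of [z], whose entries there are at least 1. *)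
pose X := [set i | 0 < z 0 i].
have z0_ge0 i : 0 <= z 0 i by have := z_ge0 0 i; rewrite !mxE ler0z.
have coverX : vertex_cover C X.
  apply/forall_inP => e eC; apply: contraTneq (z_cov 0 (enum_rank_in eC e)) => Xe0.
  rewrite row_mul_incidenceE enum_rankK_in // mxE big1 ?ler10 // => i ie.
  rewrite mxE; have /setP/(_ i) := Xe0; rewrite !inE ie andbT => /negbT.
  by rewrite -leNgt => z_le0; rewrite (@le_anti _ _ (z 0 i) 0) ?z_le0 ?z0_ge0.
apply: (@le_trans _ _ #|X|%:R); first by rewrite ler_nat alpha0_le.
rewrite -sum1_card natr_sum big_mkcond /=; apply: ler_sum => i _.
by rewrite mxE; case: ifP; rewrite inE ?ler0z // ler1z -gtz0_ge1.
Qed.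

Lemma alpha0_uniform_le : (0 < d)%N -> uniform d C -> max_flow_min_cut R C ->
  (alpha0 C * d <= n)%N.
Proof.
move=> d_gt0 unifC mfmcC; have d_gt0R : 0 < d%:R :> R by rewrite ltr0n.
have : (alpha0 C)%:R <= \sum_i (const_mx d%:R^-1 : 'rV[R]_n) 0 i.
  apply: alpha0_le_fractional_cover => //; split=> i j.
    by rewrite !mxE invr_ge0 ltW.
  by rewrite row_const_mul_incidenceE // mxE mulVf // gt_eqF.
rewrite (eq_bigr (fun=> d%:R^-1)) => [|i _]; last by rewrite mxE.
by rewrite sumr_const card_ord -[_ *+ n]mulr_natl ler_pdivlMr // -natrM ler_nat.
Qed.

Lemma fractional_perfect_matching : (0 < d)%N -> uniform d C ->
  max_flow_min_cut R C -> n = (d * alpha0 C)%N ->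
  exists2 y : 'cV[R]_#|C|, lemx 0 y & incidence_mx R C *m y = const_mx 1.
Proof.
move=> d_gt0 unifC mfmcC nE; have d_gt0R : 0 < d%:R :> R by rewrite ltr0n.
have [//|[z zA_ge0 z1_lt0]] := farkas (incidence_mx R C) (const_mx 1).
(* [t] dominates every [|z 0 i|], so that [x], which is the constant 1/d plus [z] scaled by
   [1/(d t)], stays nonnegative. *)
pose t : R := 1 + \sum_i `|z 0 i|.
have t_gt0 : 0 < t by rewrite ltr_pwDl // sumr_ge0.
have dt_gt0 : 0 < d%:R * t by apply: mulr_gt0.
pose x : 'rV[R]_n := (d%:R * t)^-1 *: (const_mx t + z).
have feasx : primal_feasible C x.
  split=> i k.
    rewrite !mxE mulr_ge0 ?invr_ge0 ?(ltW dt_gt0) // ord1.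
    have : `|z 0 k| <= t.
      rewrite /t (bigD1 k) //= addrCA lerDl addr_ge0 // sumr_ge0 //.
    by rewrite ler_norml => /andP[? _]; rewrite -lerBlDl sub0r.
  rewrite mxE -scalemxAl mulmxDl mxE [X in _ * X]mxE row_const_mul_incidenceE //.
  rewrite ler_pdivlMl // mulr1 [d%:R * t]mulrC lerDl.
  by have := zA_ge0 i k; rewrite mxE.
(* By [nE], the weight of [x] is [alpha0 C] plus the sum of [z] divided by [d t], and that sum is
   negative. *)
have /le_lt_trans/(_ _) := alpha0_le_fractional_cover mfmcC feasx.
move/(_ (alpha0 C)%:R); rewrite ltxx => absurd; exfalso; apply: notF; apply: absurd.
under eq_bigr do rewrite !mxE.
rewrite -mulr_sumr ltr_pdivrMl // big_split /= sumr_const card_ord.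
have -> : t *+ n = d%:R * t * (alpha0 C)%:R.
  by rewrite mulrAC -natrM -nE mulr_natl.
rewrite gtrDl; apply: le_lt_trans z1_lt0; rewrite mxE.
by apply: ler_sum => i _; rewrite mxE mulr1.
Qed.

Lemma perfect_matching_of_integral_packing (y : 'cV[R]_#|C|) :
  integral_mx y -> lemx 0 y -> incidence_mx R C *m y = const_mx 1 ->
  perfect_matching C [set enum_val k | k in [pred k | 0 < y k 0]].
Proof.
move=> [z yE] y_ge0 Ay1.
have y0_ge0 k : 0 <= y k 0 by have := y_ge0 k 0; rewrite mxE.
have y_ge1 k : 0 < y k 0 -> 1 <= y k 0.
  by rewrite yE mxE ltr0z ler1z -gtz0_ge1.
have sum_edges i : \sum_(k | i \in (enum_val k : {set 'I_n})) y k 0 = 1.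
  have := congr1 (fun v : 'cV_n => v i 0) Ay1; rewrite !mxE => <-.
  rewrite big_mkcond /=; apply: eq_bigr => k _.
  by rewrite mxE mulr_natl mulrb.
apply/and3P; split.
- by apply/subsetP => _ /imsetP[k _ ->]; apply: enum_valP.
- apply/trivIsetP => _ _ /imsetP[k yk_gt0 ->] /imsetP[l yl_gt0 ->] neq_kl.
  rewrite -setI_eq0; apply: contraNT neq_kl => /set0Pn[i].
  rewrite inE => /andP[ik il]; have [-> // | neq_lk] := eqVneq l k.
  have := sum_edges i; rewrite (bigD1 k) //= (bigD1 l) /=; last by rewrite il.
  (* Two distinct selected edges through [i] would give it weight at least 2, by integrality. *)
  move=> sum1; suff : 1 + 1 <= 1 :> R by rewrite gerDl ler10.
  rewrite -[leRHS]sum1 lerD ?y_ge1 // -[leLHS]addr0 lerD ?y_ge1 //.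
  by apply: sumr_ge0.
- apply/eqP/setP => i; rewrite inE; apply/bigcupP.
  have : \sum_(k | i \in (enum_val k : {set 'I_n})) y k 0 <> 0.
    by rewrite sum_edges; apply/eqP/oner_neq0.
  case/(psumr_neq0P (fun k _ => y0_ge0 k)) => k /andP[ik yk_gt0].
  by exists (enum_val k) => //; apply: imset_f.
Qed.

Lemma perfect_matching_exists : (0 < d)%N -> uniform d C ->
  max_flow_min_cut R C -> n = (d * alpha0 C)%N ->
  exists M, perfect_matching C M.
Proof.
move=> d_gt0 unifC mfmcC nE; have d_gt0R : 0 < d%:R :> R by rewrite ltr0n.
have [w w_ge0 Aw1] := fractional_perfect_matching d_gt0 unifC mfmcC nE.
have [_ [y int_y [[y_ge0 Ay_le1] y_opt]]] := mfmcC (const_mx 1%N).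
have natcol1 : natcol R (const_mx 1%N : 'cV_n) = const_mx 1.
  by apply/matrixP => i j; rewrite !mxE.
rewrite natcol1 in Ay_le1.
have le_wy : dual_value w <= dual_value y.
  by apply: y_opt; split=> // i j; rewrite natcol1 Aw1.
suff Ay1 : incidence_mx R C *m y = const_mx 1.
  by eexists; apply: perfect_matching_of_integral_packing int_y y_ge0 Ay1.
(* The slacks of the packing [y] are nonnegative, and their sum is [d] times
   [dual_value w - dual_value y], which is at most 0; so they all vanish. *)
have slack_ge0 i : 0 <= (const_mx 1 - incidence_mx R C *m y) i 0.
  by have := Ay_le1 i 0; rewrite -subr_ge0 => slack_i; rewrite mxE [X in _ + X]mxE.
have : \sum_i (const_mx 1 - incidence_mx R C *m y) i 0 <= 0.
  rewrite -Aw1 -mulmxBr sum_incidence_mul // pmulr_rle0 //.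
  have -> : dual_value (w - y) = dual_value w - dual_value y.
    by rewrite -sumrB; apply: eq_bigr => k _; rewrite !mxE.
  by rewrite subr_le0.
move=> sum_le0; apply/esym/eqP; rewrite -subr_eq0; apply/eqP/colP => i.
rewrite [RHS]mxE; apply: (psumr_eq0P (P := predT) (fun j _ => slack_ge0 j)) => //.
by apply: le_anti; rewrite sum_le0 sumr_ge0.
Qed.

End LinearPrograms.

Theorem corollary3p10 (R : realFieldType) (n d : nat) (C : {set {set 'I_n}})
    (clutterC : clutter C) (no_isolatedC : no_isolated_vertices C)
    (uniformC : uniform d C) (mfmcC : max_flow_min_cut R C) :
  (exists M : {set {set 'I_n}}, perfect_matching C M) <-> n = (d * alpha0 C)%N.
Proof.
have [n_eq0 | n_gt0] := posnP n.
  have alpha0_eq0 : alpha0 C = 0%N.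
    by apply/eqP; rewrite -leqn0 -[leqRHS]n_eq0 alpha0_le_card.
  split=> [_|_]; first by rewrite alpha0_eq0 muln0.
  exists set0; apply/and3P; split; first exact: sub0set.
    by apply/trivIsetP => e f; rewrite inE.
  by apply/eqP/setP => i; have := ltn_ord i; rewrite {2}n_eq0.
have d_gt0 := uniform_gt0 no_isolatedC uniformC n_gt0.
split=> [[M pmM] | nE]; last exact: perfect_matching_exists nE.
have cardM := card_perfect_matching uniformC pmM.
apply/eqP; rewrite eqn_leq mulnC (alpha0_uniform_le d_gt0 uniformC mfmcC) andbT.
(* Writing [n] as [#|M| * d] and cancelling [d] leaves [#|M| <= alpha0 C]. *)
rewrite -[leqLHS]cardM leq_mul2r alpha0_ge ?orbT //.
  by rewrite -[leqRHS]cardM leq_pmulr.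
by move=> X; apply: perfect_matching_le_cover pmM.
Qed.
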